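(* Let $\lambda\in\mathbb{C}$ and let $$O_p(z,\lambda)=-\frac{z^4(1-\lambda+4z+6z^2+4z^3+z^4)}{-1-4z-6z^2-4z^3+(-1+\lambda)z^4}.$$ The character of the point $z=1$ as a fixed point of the rational map $O_p(\cdot,\lambda)$ is as follows: (i) If $|\lambda-16|>64$, then $z=1$ is an attracting fixed point, and it cannot be superattracting. (ii) If $|\lambda-16|=64$, then $z=1$ is a parabolic fixed point. (iii) If $|\lambda-16|<64$, with $\lambda\neq 1$ and $\lambda\neq 16$, then $z=1$ is a repelling fixed point.
   Context: The rational map $O_p(\cdot,\lambda)$ on the Riemann sphere is the fixed point operator of the iterative method $y_k=x_k-\frac{f(x_k)}{f'(x_k)}$, $x_{k+1}=y_k-\frac{1+\lambda u_k^2}{1-2u_k}\frac{f(y_k)}{f'(x_k)}$, $u_k=\frac{f(y_k)}{f(x_k)}$, applied to a quadratic polynomial $f(z)=(z-a)(z-b)$ with $a\neq b$, after conjugation by the Möbius map $M(u)=\frac{u-a}{u-b}$. A fixed point $z_0$ of a rational map $R$ (i.e. $R(z_0)=z_0$), $z_0 \in \mathbb{C}$, is attracting if $|R'(z_0)|<1$, superattracting if $R'(z_0)=0$, repelling if $|R'(z_0)|>1$, and parabolic (neutral) if $|R'(z_0)|=1$. *)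

(* Defs.v *)
From Stdlib Require Import Reals.
From Coquelicot Require Import Coquelicot.
Local Open Scope C_scope.

(* The rational map O_p(., lambda) in the affine chart C of the Riemann sphere.
   Complex division is total, so at a zero of the denominator (a pole, or a
   common zero of numerator and denominator) the value is a dummy one.  At
   z = 1 the denominator is lambda - 16. *)
Definition Op (lambda z : C) : C :=
  - ((z ^ 4 * (1 - lambda + 4 * z + 6 * z ^ 2 + 4 * z ^ 3 + z ^ 4))
     / (- 1 - 4 * z - 6 * z ^ 2 - 4 * z ^ 3 + (- 1 + lambda) * z ^ 4)).

(* [C_derive] is a total operator, hence the complex differentiability at [z0]
   in addition to the fixed point equation.  For a rational map fixing a
   finite point [z0], differentiability at [z0] is automatic. *)
Definition fixed_point (f : C -> C) (z0 : C) : Prop :=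
  f z0 = z0 /\ ex_derive f z0.

Definition attracting (f : C -> C) (z0 : C) : Prop :=
  fixed_point f z0 /\ (Cmod (C_derive f z0) < 1)%R.

Definition superattracting (f : C -> C) (z0 : C) : Prop :=
  fixed_point f z0 /\ C_derive f z0 = 0.

Definition repelling (f : C -> C) (z0 : C) : Prop :=
  fixed_point f z0 /\ (Cmod (C_derive f z0) > 1)%R.

Definition parabolic (f : C -> C) (z0 : C) : Prop :=
  fixed_point f z0 /\ Cmod (C_derive f z0) = 1%R.

(* Main.v *)
(* Logarithmic differentiation at the fixed point 1, where numerator and
   denominator of Op take the values 16 - lambda and lambda - 16, gives the
   multiplier -64 / (lambda - 16); its modulus is compared with 1. *)
Require Import Defs.
From Stdlib Require Import Reals Lra.
From Coquelicot Require Import Coquelicot.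
Local Open Scope C_scope.

Lemma is_derive_Cplus (f g : C -> C) (x df dg : C) :
  is_derive f x df -> is_derive g x dg ->
  is_derive (fun t : C => f t + g t) x (df + dg).
Proof. exact (is_derive_plus f g x df dg). Qed.

Lemma is_derive_Copp (f : C -> C) (x df : C) :
  is_derive f x df -> is_derive (fun t : C => - f t) x (- df).
Proof. exact (is_derive_opp f x df). Qed.

Lemma is_derive_Cminus (f g : C -> C) (x df dg : C) :
  is_derive f x df -> is_derive g x dg ->
  is_derive (fun t : C => f t - g t) x (df - dg).
Proof. exact (is_derive_minus f g x df dg). Qed.

(* The uniform structures of these two normed modules on C differ (squares
   versus discs), but the definition of [is_derive] only sees the norm of the
   codomain, which is [Cmod] in both cases. *)
Lemma is_derive_C_AbsRing (f : C -> C) (x l : C) :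
  is_derive (V := C_NormedModule) f x l <->
  is_derive (V := AbsRing_NormedModule C_AbsRing) f x l.
Proof.
  split; intros [[Hp Hs Hn] Hd];
    (split; [split; [exact Hp|exact Hs|exact Hn]|exact Hd]).
Qed.

(** [is_derive_mult] views an absolute ring as a module over itself, so hypotheses and conclusion
    are transported to that structure. *)
Lemma is_derive_Cmult (f g : C -> C) (x df dg : C) :
  is_derive f x df -> is_derive g x dg ->
  is_derive (fun t : C => f t * g t) x (df * g x + f x * dg).
Proof.
  rewrite !is_derive_C_AbsRing; intros Hf Hg.
  exact (is_derive_mult (K := C_AbsRing) f g x df dg Hf Hg Cmult_comm).
Qed.

Lemma is_derive_Cconst (a x : C) : is_derive (fun _ : C => a) x (RtoC 0).
Proof. exact (is_derive_const a x). Qed.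

Lemma is_derive_Cid (x : C) : is_derive (fun t : C => t) x (RtoC 1).
Proof. apply is_derive_C_AbsRing; exact (is_derive_id x). Qed.

Lemma is_derive_Cpow (f : C -> C) (x df : C) (n : nat) :
  is_derive f x df ->
  is_derive (fun t : C => f t ^ n) x (RtoC (INR n) * f x ^ pred n * df).
Proof.
  intros Hf; induction n as [|n IHn].
  - replace (RtoC (INR 0) * f x ^ pred 0 * df) with (RtoC 0) by (simpl; ring).
    exact (is_derive_Cconst 1 x).
  - replace (RtoC (INR (S n)) * f x ^ pred (S n) * df)
      with (df * f x ^ n + f x * (RtoC (INR n) * f x ^ pred n * df)).
    + exact (is_derive_Cmult f (fun t => f t ^ n) x _ _ Hf IHn).
    (* The case split is needed because [pred 0] is [0]: there the factor [INR 0] kills the term,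
       and otherwise [f x * f x ^ pred n] is [f x ^ n]. *)
    + rewrite S_INR, RtoC_plus; destruct n; simpl; ring.
Qed.

(** The remainder 1/y - 1/x + (y-x)/x^2 equals (y-x)^2/(x^2 y), which is quadratic in y-x as long as
    y stays away from 0. *)
Lemma is_derive_Cinv (x : C) :
  x <> 0 -> is_derive Cinv x (- / (x * x)).
Proof.
  intros Hx; split.
  - exact (is_linear_scal_l (K := C_AbsRing) (V := C_NormedModule) (- / (x * x))).
  - intros x' Hx'.
    assert (E : x = x')
      by exact (is_filter_lim_locally_unique
                  (V := AbsRing_NormedModule C_AbsRing) x x' Hx').
    subst x'; clear Hx'.
    intros eps.
    assert (Px : (0 < Cmod x)%R) by (apply Cmod_gt_0; exact Hx).
    assert (Pc : (0 < Cmod x * Cmod x * Cmod x)%R)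
      by (repeat apply Rmult_lt_0_compat; exact Px).
    destruct eps as [eps Heps].
    (* The first bound forces |y| > |x|/2; given this, the second yields |y-x| < eps |x|^3/2 <= eps
       |x|^2 |y|. *)
    assert (Hd : (0 < Rmin (Cmod x / 2) (eps * (Cmod x * Cmod x * Cmod x) / 2))%R).
    { apply Rmin_pos; [lra|].
      apply Rdiv_lt_0_compat; [apply Rmult_lt_0_compat; assumption|lra]. }
    exists (mkposreal _ Hd); intros y Hy.
    change (Cmod (y - x) < Rmin (Cmod x / 2) (eps * (Cmod x * Cmod x * Cmod x) / 2))%R in Hy.
    change (Cmod (/ y - / x - (y - x) * - / (x * x)) <= eps * Cmod (y - x))%R.
    assert (H1 := Rlt_le_trans _ _ _ Hy (Rmin_l _ _)).
    assert (H2 := Rlt_le_trans _ _ _ Hy (Rmin_r _ _)).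
    assert (Py : (Cmod x / 2 < Cmod y)%R).
    { assert (T := Cmod_triangle (x - y) y).
      replace (x - y + y) with x in T by ring.
      replace (x - y) with (- (y - x)) in T by ring.
      rewrite Cmod_opp in T; lra. }
    assert (Hy0 : y <> RtoC 0) by (apply Cmod_gt_0; lra).
    replace (/ y - / x - (y - x) * - / (x * x))
      with ((y - x) * (y - x) / (x * x * y)) by (field; auto).
    rewrite Cmod_div by (repeat apply Cmult_neq_0; assumption).
    rewrite !Cmod_mult.
    assert (Pxy : (0 < Cmod x * Cmod x * Cmod y)%R)
      by (repeat apply Rmult_lt_0_compat; lra).
    apply Rmult_le_reg_r with (1 := Pxy).
    unfold Rdiv; rewrite Rmult_assoc, Rinv_l, Rmult_1_r by lra.
    rewrite (Rmult_comm eps), !Rmult_assoc.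
    apply Rmult_le_compat_l; [apply Cmod_ge_0|].
    assert (Q : (eps * (Cmod x * Cmod x) * (Cmod x / 2)
                 <= eps * (Cmod x * Cmod x) * Cmod y)%R).
    { apply Rmult_le_compat_l; [|lra].
      repeat apply Rmult_le_pos; lra. }
    lra.
Qed.

(** Product rule for f and 1/g, the latter by the chain rule, which takes the derivative of the
    inner function in the ring's own module structure. *)
Lemma is_derive_Cdiv (f g : C -> C) (x df dg : C) :
  g x <> 0 -> is_derive f x df -> is_derive g x dg ->
  is_derive (fun t : C => f t / g t) x ((df * g x - f x * dg) / (g x * g x)).
Proof.
  intros Hg Hf Hdg.
  replace ((df * g x - f x * dg) / (g x * g x))
    with (df * / g x + f x * (dg * - / (g x * g x))) by (field; exact Hg).
  apply (is_derive_Cmult f (fun t => / g t)); [exact Hf|].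
  exact (is_derive_comp Cinv g x _ _ (is_derive_Cinv _ Hg)
           (proj1 (is_derive_C_AbsRing g x dg) Hdg)).
Qed.

(* Syntactic dispatch: plain [apply] tries to unfold complex arithmetic when a
   rule does not match, which does not terminate in reasonable time. *)
Ltac Cderive :=
  lazymatch goal with
  | |- is_derive (fun _ => ?c) ?x _ => exact (is_derive_Cconst c x)
  | |- is_derive (fun t => t) ?x _ => exact (is_derive_Cid x)
  | |- is_derive (fun t => Cplus (@?f t) (@?g t)) ?x _ =>
      refine (is_derive_Cplus f g x _ _ _ _); Cderive
  | |- is_derive (fun t => Cminus (@?f t) (@?g t)) ?x _ =>
      refine (is_derive_Cminus f g x _ _ _ _); Cderive
  | |- is_derive (fun t => Copp (@?f t)) ?x _ =>
      refine (is_derive_Copp f x _ _); Cderive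
  | |- is_derive (fun t => Cmult (@?f t) (@?g t)) ?x _ =>
      refine (is_derive_Cmult f g x _ _ _ _); Cderive
  | |- is_derive (fun t => Cdiv (@?f t) (@?g t)) ?x _ =>
      refine (is_derive_Cdiv f g x _ _ _ _ _); [|Cderive|Cderive]
  | |- is_derive (fun t => Cpow (@?f t) ?n) ?x _ =>
      refine (is_derive_Cpow f x _ n _); Cderive
  end.

(** Write [Op] as -N/D. Since N(1) = -D(1), the quotient rule collapses to -(N'(1) + D'(1))/D(1).
    Here N'(1) = 96 - 4 lambda and D'(1) = 4 lambda - 32, so lambda cancels in the sum, leaving
    64. *)
Lemma is_derive_Op_1 (lambda : C) :
  lambda <> 16 -> is_derive (Op lambda) (RtoC 1) (- (64 / (lambda - 16))).
Proof.
  intros Hl.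
  assert (Hl' := Cminus_eq_contra _ _ Hl).
  assert (D1 : - 1 - 4 * 1 - 6 * 1 ^ 2 - 4 * 1 ^ 3 + (- 1 + lambda) * 1 ^ 4
               = lambda - 16) by ring.
  (* The derivative is left as an existential variable, filled in by [Cderive] and only afterwards
     identified with the closed form. *)
  eassert (H : is_derive (Op lambda) (RtoC 1) _).
  { unfold Op; Cderive; cbv beta; rewrite D1; exact Hl'. }
  match type of H with is_derive _ _ ?l =>
    replace (- (64 / (lambda - 16))) with l; [exact H|] end.
  cbv beta; rewrite D1; simpl INR; simpl pred; rewrite !RtoC_plus.
  field; exact Hl'.
Qed.

Lemma fixed_point_Op_1 (lambda : C) :
  lambda <> 16 -> fixed_point (Op lambda) 1.
Proof.
  intros Hl; split.
  - unfold Op; field.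
    intros H; apply (Cminus_eq_contra _ _ Hl); rewrite <- H; ring.
  - eexists; apply is_derive_Op_1, Hl.
Qed.

Lemma Cmod_C_derive_Op_1 (lambda : C) :
  lambda <> 16 ->
  Cmod (C_derive (Op lambda) 1) = (64 / Cmod (lambda - 16))%R.
Proof.
  intros Hl.
  rewrite (is_C_derive_unique _ _ _ (is_derive_Op_1 _ Hl)), Cmod_opp, Cmod_div.
  - rewrite Cmod_R, Rabs_pos_eq; lra.
  - exact (Cminus_eq_contra _ _ Hl).
Qed.

Theorem theorem2 (lambda : C) :
  ((Cmod (lambda - 16) > 64)%R ->
     attracting (Op lambda) 1 /\ ~ superattracting (Op lambda) 1)
  /\ (Cmod (lambda - 16) = 64%R ->
     parabolic (Op lambda) 1)
  /\ ((Cmod (lambda - 16) < 64)%R -> lambda <> 1 -> lambda <> 16 ->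
     repelling (Op lambda) 1).
Proof.
  assert (N16 : (0 < Cmod (lambda - 16))%R -> lambda <> 16).
  { intros H ->; revert H; replace (16 - 16) with (RtoC 0) by ring.
    rewrite Cmod_0; lra. }
  split; [|split].
  - intros H; assert (Hl : lambda <> 16) by (apply N16; lra).
    assert (M := Cmod_C_derive_Op_1 _ Hl).
    split; [split; [exact (fixed_point_Op_1 _ Hl)|]|].
    + rewrite M; apply Rlt_div_l; lra.
    (* A vanishing multiplier would contradict the positivity of 64/|lambda - 16|. *)
    + intros [_ H0]; rewrite H0, Cmod_0 in M.
      assert (0 < 64 / Cmod (lambda - 16))%R by (apply Rdiv_lt_0_compat; lra).
      lra.
  - intros H; assert (Hl : lambda <> 16) by (apply N16; lra).
    split; [exact (fixed_point_Op_1 _ Hl)|].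
    rewrite (Cmod_C_derive_Op_1 _ Hl), H; field.
  - intros H _ Hl.
    split; [exact (fixed_point_Op_1 _ Hl)|].
    rewrite (Cmod_C_derive_Op_1 _ Hl).
    assert (0 < Cmod (lambda - 16))%R
      by (apply Cmod_gt_0, Cminus_eq_contra, Hl).
    apply Rlt_gt, Rlt_div_r; lra.
Qed.
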